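(* For every nonnegative integer $\ell$, every nonnegative integer $n$ and every complex number $x$, $$\sum_{k=0}^n (q^{-3n};q^3)_k \left[\begin{matrix} x,\ q^{1-\ell}/x\\ q,\ -q^{1-\ell},\ q^{1/2},\ -q^{1/2},\ q^{-3n}\end{matrix}\middle| q\right]_k q^k = \left[\begin{matrix} x,\ -x\\ x^2,\ -1\end{matrix}\middle|q\right]_\ell \sum_{i=0}^{\ell}(-1)^i q^{\ell i}\,\frac{1-x^2q^{2i-1}}{1-x^2q^{-1}}\left[\begin{matrix} q^{-\ell},\ x^2q^{-1}\\ q,\ x^2q^{\ell}\end{matrix}\middle|q\right]_i\left[\begin{matrix} q^{1+i}x,\ q^{2-i}/x\\ q,\ q^2\end{matrix}\middle|q^3\right]_n.$$
   Context: $q$ is a complex number with a fixed square root $q^{1/2}$, and $q^{r/2}$ means $(q^{1/2})^r$. For a complex number $a$, a base $p$ and a nonnegative integer $m$, the $q$-shifted factorial is $(a;p)_m=\prod_{j=0}^{m-1}(1-ap^j)$ with $(a;p)_0=1$. The bracket notation means $\left[\begin{matrix} a_1,\dots,a_r\\ b_1,\dots,b_s\end{matrix}\middle|p\right]_m=\frac{(a_1;p)_m\cdots(a_r;p)_m}{(b_1;p)_m\cdots(b_s;p)_m}$ (used with $p=q$ and $p=q^3$). The identity is understood for values of the parameters for which no denominator vanishes. *)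

(* Defs.v *)
From HB Require Import structures.
From mathcomp Require Import all_boot all_order all_algebra.
From mathcomp Require Import reals.
From mathcomp Require Import complex.
Set Implicit Arguments.
Unset Strict Implicit.
Unset Printing Implicit Defensive.
Import GRing.Theory.
Local Open Scope ring_scope.

Definition qpoch (F : fieldType) (a p : F) (m : nat) : F :=
  \prod_(j < m) (1 - a * p ^+ j).

(* The bracket [us; ds | p]_m: upper parameters us, lower parameters ds. *)
Definition qbracket (F : fieldType) (us ds : seq F) (p : F) (m : nat) : F :=
  (\prod_(a <- us) qpoch a p m) / (\prod_(b <- ds) qpoch b p m).

(* x / 0 = 0 in a fieldType, so nonvanishing of the denominators has to be
   assumed separately. *)
Definition qbracket_defined (F : fieldType) (ds : seq F) (p : F) (m : nat)
    : Prop :=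
  forall b, b \in ds -> qpoch b p m != 0.

(* Main.v *)
Require Import Defs.
From HB Require Import structures.
From mathcomp Require Import all_boot all_order all_algebra.
From mathcomp Require Import reals.
From mathcomp Require Import complex.
From mathcomp Require Import ring zify.
Set Implicit Arguments.
Unset Strict Implicit.
Unset Printing Implicit Defensive.
Import GRing.Theory.
Local Open Scope ring_scope.

(* For l = 0 the sum is a cubic summation, proved by a WZ recurrence in n.  For
   general l, the quotient (x, q^(1-l)/x)_k / (-q^(1-l))_k is expanded by a
   terminating very-well-poised 6phi5 sum as a combination of the quotients
   (q^i x, q^(1-i)/x)_k / (-q)_k; summing over k first leaves the l = 0 case at
   q^i x.
   The factor (-q)_k, and others met on the way, may vanish although all the
   denominators of the identity are nonzero (q a primitive 6th root of unity,
   l = 1, n = 3).  So the argument is run over the fraction field F(X) with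
   q = X, which is not a root of unity, and both sides, being regular at X = q,
   are then evaluated there. *)

(** * Shifted factorials and telescoping of finite sums *)

Section QPoch.
Variable F : fieldType.
Implicit Types (a p q x : F) (i k l m n : nat).

Lemma qpoch0 a p : qpoch a p 0 = 1.
Proof. by rewrite /qpoch big_ord0. Qed.

Lemma qpochS a p m : qpoch a p m.+1 = qpoch a p m * (1 - a * p ^+ m).
Proof. by rewrite /qpoch big_ord_recr. Qed.

Lemma qpochSl a p m : qpoch a p m.+1 = (1 - a) * qpoch (a * p) p m.
Proof.
rewrite /qpoch big_ord_recl expr0 mulr1; congr (_ * _).
by apply: eq_bigr => j _; rewrite exprS mulrA.
Qed.

Lemma qpoch_shift a p m :
  qpoch a p m * (1 - a * p ^+ m) = (1 - a) * qpoch (a * p) p m.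
Proof. by rewrite -qpochS qpochSl. Qed.

(** The contiguity relation by which the recurrences below bring factorials with shifted parameters
    to a common one. *)
Lemma qpoch_mulr a p m : a != 1 ->
  qpoch (a * p) p m = qpoch a p m * (1 - a * p ^+ m) / (1 - a).
Proof.
by move=> a1; rewrite qpoch_shift mulrAC mulfV ?mul1r // subr_eq0 eq_sym.
Qed.

Lemma qpoch_neq0 a p m :
  (forall j, (j < m)%N -> a * p ^+ j != 1) -> qpoch a p m != 0.
Proof.
by move=> h; apply/prodf_neq0 => j _; rewrite subr_eq0 eq_sym h.
Qed.

(** Factorwise difference of squares; it is what removes the square root of q from the identity. *)
Lemma qpoch_mul_opp a p m : qpoch a p m * qpoch (- a) p m = qpoch (a ^+ 2) (p ^+ 2) m.
Proof.
rewrite /qpoch -big_split; apply: eq_bigr => j _ /=.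
by rewrite -exprM mulnC exprM; ring.
Qed.

(** WZ telescoping when the first sum has one extra term: that term is cancelled by [G m], so the
    certificate is never evaluated beyond [m], where its denominators could vanish. *)
Lemma telescope_sum (t u G : nat -> F) m :
    G 0%N = 0 -> G m + t m = 0 ->
    (forall k, (k < m)%N -> t k - u k = G k.+1 - G k) ->
  \sum_(0 <= k < m.+1) t k = \sum_(0 <= k < m) u k.
Proof.
move=> G0 Gm h; rewrite big_nat_recr //=; apply/eqP.
rewrite -subr_eq0 addrAC -sumrB big_nat.
rewrite (eq_bigr (fun k => G k.+1 - G k)) => [|k /andP[_ /h] //].
by rewrite -big_nat telescope_sumr // G0 subr0 Gm.
Qed.

Lemma add1_exprn_neq0 q m :
  (forall j, (0 < j)%N -> q ^+ j != 1) -> (0 < m)%N -> 1 + q ^+ m != 0.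
Proof.
move=> q1 m0; apply: contra (q1 (m * 2) _); last by rewrite muln_gt0 m0.
by rewrite exprM addrC addr_eq0 => /eqP ->; rewrite sqrrN expr1n.
Qed.

(** * The cubic summation, that is the case l = 0 *)

Section Cubic.
Variables (q x : F).
Hypotheses (q0 : q != 0) (x0 : x != 0).
Hypothesis q1 : forall m, (0 < m)%N -> q ^+ m != 1.

Let qX_neq0 m : q ^+ m != 0. Proof. exact: expf_neq0. Qed.

Let qXD1 i j : (i != j)%N -> q ^+ i - q ^+ j != 0.
Proof.
wlog ij : i j / (i < j)%N => [h|_].
  case: (ltngtP i j) => // ij _; first by apply: h; rewrite // ltn_eqF.
  by rewrite -opprB oppr_eq0 h // ltn_eqF.
rewrite -(subnKC (ltnW ij)) exprD -[X in X - _]mulr1 -mulrBr.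
by rewrite mulf_neq0 // subr_eq0 eq_sym q1 // subn_gt0.
Qed.

Let qXp1 m : (0 < m)%N -> 1 + q ^+ m != 0.
Proof. exact: add1_exprn_neq0. Qed.

(** Summand of the left side at l = 0, with the factors at the two square roots of q merged into
    [qpoch q (q ^+ 2) k]. *)
Definition cubic_term n k : F :=
  qpoch (q ^+ (3 * n))^-1 (q ^+ 3) k * (qpoch x q k * qpoch (q / x) q k)
  / (qpoch q q k * qpoch (- q) q k * qpoch q (q ^+ 2) k
     * qpoch (q ^+ (3 * n))^-1 q k) * q ^+ k.

(** Both sides are 1 at n = 0 and satisfy the same first-order recurrence in n. *)
Lemma cubic_sum n :
  \sum_(0 <= k < n.+1) cubic_term n k =
  qpoch (q * x) (q ^+ 3) n * qpoch (q ^+ 2 / x) (q ^+ 3) n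
  / (qpoch q (q ^+ 3) n * qpoch (q ^+ 2) (q ^+ 3) n).
Proof.
elim: n => [|n IHn].
  by rewrite big_nat1 /cubic_term !qpoch0 expr0 !mulr1 invr1.
rewrite !qpochS -exprM; set N := q ^+ (3 * n).
have qN j : (0 < j)%N -> 1 - q ^+ j * N != 0.
  by move=> j0; rewrite -exprD subr_eq0 eq_sym q1 // addn_gt0 j0.
have N0 : N != 0 by exact: qX_neq0.
(* The ratio of the right side at n + 1 to the right side at n. *)
set rho := (1 - q * N * x) * (1 - q ^+ 2 * N / x)
  / ((1 - q * N) * (1 - q ^+ 2 * N)).
transitivity (rho * \sum_(0 <= k < n.+1) cubic_term n k); last first.
  have h1 : qpoch q (q ^+ 3) n != 0.
    by apply: qpoch_neq0 => j _; rewrite -exprM -exprS q1.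
  have h2 : qpoch (q ^+ 2) (q ^+ 3) n != 0.
    by apply: qpoch_neq0 => j _; rewrite -exprM -exprD q1.
  have := qN 1%N isT; have := qN 2%N isT; rewrite expr1 => h3 h4.
  by rewrite IHn /rho; field; rewrite h1 h2 h3 h4.
rewrite mulr_sumr.
(* WZ certificate of the recurrence in [n]; its rational factor is free of [x]. *)
pose G k := - (q ^+ 2 * N * (1 - q ^+ k ^+ 2) * (q - q ^+ k ^+ 2))
  / (q ^+ k * (q ^+ 2 * N - q ^+ k) * (q ^+ 3 * N - q ^+ k))
  * cubic_term n.+1 k.
have E3 : q ^+ (3 * n.+1) = q ^+ 3 * N by rewrite mulnS exprD.
have N3 j k : (0 < j)%N -> (k < j + 3 * n)%N -> q ^+ j * N - q ^+ k != 0.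
  by move=> j0 kn; rewrite -exprD qXD1 // neq_ltn kn orbT.
apply: (telescope_sum (G := G)).
- by rewrite /G expr0 expr1n subrr mulr0 mul0r oppr0 !mul0r.
(* At k = n + 1, where N is the cube of q^n, the rational factor of the certificate reduces to
   -1. *)
- have -> : G n.+1 = - cubic_term n.+1 n.+1; last by rewrite addNr.
  rewrite /G -[RHS]mulN1r; congr (_ * _).
  have hN : N = q ^+ n ^+ 3 by rewrite /N mulnC exprM.
  have h2 := N3 2%N n.+1 isT (ltac:(lia)).
  have h3 := N3 3%N n.+1 isT (ltac:(lia)).
  have K0 := qX_neq0 n.
  move: h2 h3 K0; rewrite hN [q ^+ n.+1]exprS; set K := q ^+ n => h2 h3 K0.
  by field; rewrite exprMn h2 h3 K0 q0.
move=> k kn; rewrite /G /cubic_term !qpochS E3 -/N.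
have K0 := qX_neq0 k.
have NV j : (0 < j)%N -> (q ^+ j * N)^-1 != 1.
  by move=> j0; rewrite invr_eq1 -exprD q1 // addn_gt0 j0.
(* Going from n + 1 to n multiplies the parameter by q^3: one step in base q^3 ([sA]), three steps
   in base q ([sB]). *)
have sA : qpoch N^-1 (q ^+ 3) k = qpoch (q ^+ 3 * N)^-1 (q ^+ 3) k
    * (1 - (q ^+ 3 * N)^-1 * q ^+ k ^+ 3) / (1 - (q ^+ 3 * N)^-1).
  rewrite [in LHS](_ : N^-1 = (q ^+ 3 * N)^-1 * q ^+ 3); last by field; rewrite N0.
  by rewrite qpoch_mulr ?NV // -!exprM [(3 * k)%N]mulnC.
have sB : qpoch N^-1 q k = qpoch (q ^+ 3 * N)^-1 q k
    * (1 - (q ^+ 3 * N)^-1 * q ^+ k) / (1 - (q ^+ 3 * N)^-1)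
    * (1 - (q ^+ 2 * N)^-1 * q ^+ k) / (1 - (q ^+ 2 * N)^-1)
    * (1 - (q ^+ 1 * N)^-1 * q ^+ k) / (1 - (q ^+ 1 * N)^-1).
  have e j : (q ^+ j * N)^-1 = (q ^+ j.+1 * N)^-1 * q.
    by rewrite exprS; field; rewrite N0 q0 qX_neq0.
  by rewrite -[N]mul1r -(expr0 q) !(e 0%N, e 1%N, e 2%N) expr0 mul1r
             !qpoch_mulr -?e ?NV.
rewrite sA sB !expr1 -!exprM ![(_ * k)%N]mulnC !exprM [q ^+ k.+1]exprS.
have h1 := N3 1%N k isT (ltac:(lia)); have h2 := N3 2%N k isT (ltac:(lia)).
have h3 := N3 3%N k isT (ltac:(lia)).
have d1 : 1 - q * q ^+ k != 0 by rewrite -exprS subr_eq0 eq_sym q1.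
have d2 : 1 + q * q ^+ k != 0 by rewrite -exprS qXp1.
have d3 : 1 - q * q ^+ k ^+ 2 != 0.
  by rewrite -exprM -exprS subr_eq0 eq_sym q1.
have d4 : qpoch q q k != 0.
  by apply: qpoch_neq0 => j _; rewrite -exprS q1.
have d5 : qpoch (- q) q k != 0.
  apply/prodf_neq0 => j _; by rewrite mulNr opprK -exprS qXp1.
have d6 : qpoch q (q ^+ 2) k != 0.
  by apply: qpoch_neq0 => j _; rewrite -exprM -exprS q1.
have d7 : qpoch (q ^+ 3 * N)^-1 q k != 0.
  (* The factors are 1 - q^(j-3n-3) with j < k <= n, so the exponent stays negative. *)
  apply: qpoch_neq0 => j jk; rewrite -subr_eq0.
  have -> : (q ^+ 3 * N)^-1 * q ^+ j - 1 = (q ^+ j - q ^+ 3 * N) / (q ^+ 3 * N).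
    by field; rewrite N0 q0.
  have jn : (j < 3 + 3 * n)%N by move: jk kn; clear; lia.
  by rewrite mulf_neq0 ?invr_neq0 ?mulf_neq0 ?qX_neq0 // -exprD qXD1 // ltn_eqF.
have n1 := qN 1%N isT; have n2 := qN 2%N isT; have n3 := qN 3%N isT.
rewrite /rho.
(* Once the factorials and the powers [q ^+ k] and [N] are free variables, a rational identity
   remains. *)
move: h1 h2 h3 d1 d2 d3 d4 d5 d6 d7 n1 n2 n3 N0 K0.
move: (q ^+ k) (qpoch (q ^+ 3 * N)^-1 q k) (qpoch (q ^+ 3 * N)^-1 _ k).
move: (qpoch q _ k) (qpoch q _ k) (qpoch (- q) _ k) (qpoch x _ k) (qpoch (q / x) _ k).
move: {sA sB NV N3 E3 G rho qN IHn} N {kn} => N.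
move=> c1 c2 c3 c4 c5 K c6 c7; rewrite expr1.
move=> h1 h2 h3 d1 d2 d3 d4 d5 d6 d7 n1 n2 n3 N0 K0.
field.
rewrite mulNr opprK.
rewrite [q ^+ 2 * N - q * K](_ : _ = q * (q * N - K)); last by ring.
rewrite [q ^+ 3 * N - q * K](_ : _ = q * (q ^+ 2 * N - K)); last by ring.
rewrite !mulf_neq0 // -![_ * N - 1]opprB !oppr_eq0.
by rewrite h1 h2 h3 d1 d2 d3 d4 d5 d6 d7 n1 n2 n3 N0 K0 x0 q0.
Qed.
End Cubic.
End QPoch.

(** * Expansion of the quotient depending on l by a very-well-poised sum *)

Section Expansion.
Variables (F : fieldType) (q x : F).

(** The prefactor of the right side is included, and q^(2i-1) is written [q ^+ i ^+ 2 / q] so that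
    only natural exponents occur. *)
Definition expansion_coef l i : F :=
  qpoch x q l * qpoch (- x) q l / (qpoch (x ^+ 2) q l * qpoch (- 1) q l)
  * ((- 1) ^+ i * q ^+ (l * i) * ((1 - x ^+ 2 * (q ^+ i ^+ 2 / q)) / (1 - x ^+ 2 / q))
     * (qpoch (q ^+ l)^-1 q i * qpoch (x ^+ 2 / q) q i
        / (qpoch q q i * qpoch (x ^+ 2 * q ^+ l) q i))).

Definition expansion_term l k i : F :=
  expansion_coef l i * (qpoch (q ^+ i * x) q k * qpoch (q / (q ^+ i * x)) q k).

(** Kept apart from the general expansion because x^2 = 1 is admissible when l = 0. *)
Lemma bracket_expansion0 k :
    q != 0 -> q - x ^+ 2 != 0 -> (forall j, 1 + q ^+ j.+1 != 0) ->
  qpoch x q k * qpoch (q / (q ^+ 0 * x)) q k * qpoch (- q) q k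
    / qpoch (- (q / q ^+ 0)) q k
  = \sum_(0 <= i < 1) expansion_term 0 k i.
Proof.
move=> q0 h q1.
rewrite big_nat1 /expansion_term /expansion_coef !qpoch0 muln0 !expr0 expr1n !mul1r.
rewrite divr1 invr1 !mul1r !mulr1 divff ?mul1r ?mulfK //.
  by apply/prodf_neq0 => j _; rewrite mulNr opprK -exprS.
apply: contra h; rewrite !subr_eq0 => /eqP h.
by rewrite -[q]mul1r h divfK.
Qed.

Hypotheses (q0 : q != 0) (x0 : x != 0) (two0 : (2 : F) != 0).
Hypothesis q1 : forall m, (0 < m)%N -> q ^+ m != 1.
Hypothesis x2 : forall i j, x ^+ 2 * q ^+ i != q ^+ j.

Let qX_neq0 m : q ^+ m != 0. Proof. exact: expf_neq0. Qed.

Let qXp1 m : 1 + q ^+ m != 0.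
Proof.
(* At m = 0 this is 2, the first factor of [qpoch (- 1) q l]. *)
case: m => [|m]; last exact: add1_exprn_neq0.
by rewrite expr0 -[1 + 1]/(2%:R).
Qed.

Let qXD i j : q ^+ i + q ^+ j != 0.
Proof.
wlog ij : i j / (i <= j)%N => [h|].
  by case: (leqP i j) => [/h //|/ltnW /h]; rewrite addrC.
by rewrite -(subnKC ij) exprD -[X in X + _]mulr1 -mulrDr mulf_neq0.
Qed.

Let xqB i j : q ^+ i * x - q ^+ j != 0.
Proof.
(* Squaring a supposed equality contradicts [x2]. *)
apply: contra (x2 (i * 2) (j * 2)); rewrite subr_eq0 !exprM => /eqP <-.
by rewrite exprMn mulrC.
Qed.

Let xqD i j : q ^+ i * x + q ^+ j != 0.
Proof.
apply: contra (x2 (i * 2) (j * 2)); rewrite addr_eq0 !exprM => /eqP h.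
by rewrite -exprMn mulrC h sqrrN.
Qed.

(* A terminating very-well-poised 6phi5 sum with parameters
   [x ^+ 2 / q; q ^- l, x * q ^+ k, - x]. *)
Lemma bracket_expansion l k :
  qpoch x q k * qpoch (q / (q ^+ l * x)) q k * qpoch (- q) q k
    / qpoch (- (q / q ^+ l)) q k
  = \sum_(0 <= i < l.+1) expansion_term l k i.
Proof.
have pq j : qpoch q q j != 0.
  by apply: qpoch_neq0 => i _; rewrite -exprS q1.
elim: l => [|l IHl].
  apply: bracket_expansion0 => //.
  by have := x2 0 1; rewrite expr0 expr1 mulr1 subr_eq0 eq_sym.
set M := q ^+ l; set K := q ^+ k.
have M0 : M != 0 := qX_neq0 l; have K0 : K != 0 := qX_neq0 k.
(* The ratio of the left side at l + 1 to the left side at l: one contiguity step in each of the two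
   factorials that depend on l. *)
pose r := (M * x - 1) * (M + K) / ((M * x - K) * (M + 1)).
have m1 : M * x - 1 != 0 := xqB l 0.
have m2 : M * x - K != 0 := xqB l k.
have m3 : M + 1 != 0 := qXD l 0.
have m4 : M * x + 1 != 0 := xqD l 0.
have m5 : q * M - 1 != 0 by rewrite -exprS subr_eq0 q1.
have eM : q ^+ l.+1 = q * M by rewrite exprS.
transitivity (r * \sum_(0 <= i < l.+1) expansion_term l k i).
  rewrite -IHl.
  have -> : qpoch (q / (q ^+ l * x)) q k = qpoch (q / (q ^+ l.+1 * x)) q k
     * (1 - (q / (q ^+ l.+1 * x)) * K) / (1 - (q / (q ^+ l.+1 * x))).
    rewrite -qpoch_mulr ?eM -/M; first by congr qpoch; field; rewrite x0 q0 M0.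
    rewrite -subr_eq0 [X in X != 0](_ : _ = - (M * x - 1) / (M * x)).
      by rewrite mulf_neq0 ?oppr_eq0 ?invr_neq0 ?mulf_neq0.
    by rewrite ?eM; field; rewrite x0 q0 M0.
  have -> : qpoch (- (q / q ^+ l)) q k = qpoch (- (q / q ^+ l.+1)) q k
     * (1 + (q / q ^+ l.+1) * K) / (1 + q / q ^+ l.+1).
    have -> : - (q / q ^+ l) = - (q / q ^+ l.+1) * q.
      by rewrite eM -/M; field; rewrite q0 M0.
    rewrite qpoch_mulr ?mulNr ?opprK //.
    rewrite -subr_eq0 [X in X != 0](_ : _ = - (M + 1) / M).
      by rewrite mulf_neq0 ?oppr_eq0 ?invr_neq0.
    by rewrite eM -/M; field; rewrite q0 M0.
  have pn : qpoch (- (q / q ^+ l.+1)) q k != 0.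
    apply/prodf_neq0 => j _; rewrite mulNr opprK.
    rewrite [X in X != 0](_ : _ = (q ^+ l + q ^+ j) / q ^+ l) ?mulf_neq0 ?invr_neq0 //.
    by rewrite eM -/M; field; rewrite q0 M0.
  move: pn; rewrite eM /r.
  move: (qpoch _ q k) (qpoch _ q k) (qpoch _ q k) (qpoch _ q k) => c1 c2 c3 c4 pn.
  have m6 : M + K != 0 := qXD l k.
  by field; rewrite M0 q0 m3 m6 pn x0 m1 m2.
rewrite mulr_sumr.
(* WZ certificate of the recurrence in [l]. *)
pose G i := M * (q + x * q ^+ i) * (1 - q ^+ i) * (1 - x ^+ 2 * M * q ^+ i)
   * (q ^+ i * x - q * K) / ((M * x - K) * (M * x + 1) * (q * M - 1) * q ^+ i
      * (q - x ^+ 2 * q ^+ i ^+ 2)) * expansion_term l.+1 k i.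
have x2q i : q - x ^+ 2 * q ^+ i ^+ 2 != 0.
  by have := x2 (i * 2) 1; rewrite -exprM subr_eq0 eq_sym expr1.
symmetry; apply: (telescope_sum (G := G)).
- by rewrite /G expr0 subrr mulr0 !mul0r.
(* At i = l + 1 the rational factor of the certificate is again -1. *)
- have -> : G l.+1 = - expansion_term l.+1 k l.+1; last by rewrite addNr.
  rewrite /G -[RHS]mulN1r; congr (_ * _).
  have := x2q l.+1; rewrite eM => h.
  by field; rewrite exprMn h q0 M0 m5 m4 m2.
move=> i il; rewrite /G /expansion_term /expansion_coef.
have hi := x2q i; have hi1 := x2q i.+1.
have h6 : 1 - x ^+ 2 * M != 0.
  by have := x2 l 0; rewrite subr_eq0 eq_sym expr0.
(* [sM] and [sX] undo the shift of l, [sP] and [sQ] the shift of i; all terms then share the same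
   factorials and the difference equation becomes rational. *)
have sM : qpoch (q ^+ l)^-1 q i = qpoch (q ^+ l.+1)^-1 q i
    * (1 - (q ^+ l.+1)^-1 * q ^+ i) / (1 - (q ^+ l.+1)^-1).
  rewrite -qpoch_mulr ?invr_eq1 ?q1 // eM -/M.
  by congr qpoch; field; rewrite q0 M0.
have sX : qpoch (x ^+ 2 * q ^+ l.+1) q i = qpoch (x ^+ 2 * q ^+ l) q i
    * (1 - x ^+ 2 * q ^+ l * q ^+ i) / (1 - x ^+ 2 * q ^+ l).
  rewrite -qpoch_mulr ?eM -/M; first by congr qpoch; ring.
  by have := x2 l 0; rewrite expr0.
have h7 : q ^+ i * x - 1 != 0 := xqB i 0.
have sP : qpoch (q ^+ i.+1 * x) q k = qpoch (q ^+ i * x) q k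
    * (1 - q ^+ i * x * q ^+ k) / (1 - q ^+ i * x).
  rewrite -qpoch_mulr -1?subr_eq0 // exprS.
  by congr qpoch; ring.
have sQ : qpoch (q / (q ^+ i * x)) q k = qpoch (q / (q ^+ i.+1 * x)) q k
    * (1 - q / (q ^+ i.+1 * x) * q ^+ k) / (1 - q / (q ^+ i.+1 * x)).
  have e : q / (q ^+ i.+1 * x) = (q ^+ i * x)^-1.
    by rewrite exprS; field; rewrite x0 q0 qX_neq0.
  rewrite e -qpoch_mulr; first by rewrite mulrC.
  by rewrite invr_eq1 -subr_eq0.
have pl : qpoch x q l != 0.
  by apply: qpoch_neq0 => j _; rewrite mulrC -subr_eq0 (xqB j 0).
have plN : qpoch (- x) q l != 0.
  by apply/prodf_neq0 => j _; rewrite mulNr opprK addrC mulrC (xqD j 0).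
have pl2 : qpoch (x ^+ 2) q l != 0.
  by apply: qpoch_neq0 => j _; rewrite -(expr0 q) x2.
have plm : qpoch (- 1) q l != 0.
  by apply/prodf_neq0 => j _; rewrite mulNr opprK mul1r.
have pM : qpoch (x ^+ 2 * q ^+ l) q i != 0.
  by apply: qpoch_neq0 => j _; rewrite -mulrA -exprD -(expr0 q) x2.
have h8 : 1 - x ^+ 2 * M * q ^+ i != 0.
  by rewrite subr_eq0 eq_sym -mulrA -exprD -(expr0 q) x2.
have h9 : 1 - x ^+ 2 * (q * M) * q ^+ i != 0.
  by rewrite subr_eq0 eq_sym -eM -mulrA -exprD -(expr0 q) x2.
have ha : q - x ^+ 2 != 0.
  by have := x2 0 1; rewrite expr0 expr1 mulr1 subr_eq0 eq_sym.
have hb : 1 - q * q ^+ i != 0 by rewrite -exprS subr_eq0 eq_sym q1.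
have I0 := qX_neq0 i.
have eI : q ^+ i.+1 = q * q ^+ i by rewrite exprS.
have pqi := pq i.
rewrite -/M in pM.
move: hi hi1; rewrite sM !(qpochS _ _ i) !(qpochS _ _ l) sX sP sQ.
rewrite (mulSn l) (mulSn l) (mulnS l) !exprD [(- 1) ^+ i.+1]exprS eI eM -/K -/M /r.
move: {sM sX sP sQ eI G x2q eM r IHl} pl plN pl2 plm pM pqi h6 h7 h8 h9 ha hb I0.
move: (qpoch x q l) (qpoch (- x) q l) (qpoch (x ^+ 2) q l) (qpoch (- 1) q l).
move: (qpoch q q i) (qpoch (x ^+ 2 * M) q i) (qpoch (x ^+ 2 / q) q i).
move: (qpoch (q * M)^-1 q i) (qpoch _ q k) (qpoch _ q k).
move: ((- 1) ^+ i) (q ^+ (l * i)).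
move: (q ^+ i).
move: (M) (K) M0 K0 m1 m2 m3 m4 m5 => {il K} {}M K.
move=> M0 K0 m1 m2 m3 m4 m5 I c1 c2 c3 c4 c5 c6 c7 c8 c9 c10 c11 c12.
move=> n1 n2 n3 n4 n5 n6 n7 n8 n9 n10 n11 n12 n13 n14 n15.
field.
have -> : 1 - -1 * M = M + 1 by ring.
rewrite ![(x * _) ^+ 2]exprMn -(opprB (I * x) 1) oppr_eq0 q0 x0.
by rewrite M0 m2 m3 m4 m5 n3 n4 n5 n6 n7 n8 n9 n10 n11 n12 n13 n14 n15.
Qed.
End Expansion.

(** * The identity when q is not a root of unity *)

Section Identity.
Variable F : fieldType.
Implicit Types (q x : F) (i k l n : nat).

(** Free of the square root of q, so that it makes sense at q = X in F(X), where X has no square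
    root. *)
Definition cubic_lhs q x l n : F :=
  \sum_(0 <= k < n.+1)
     qpoch (q ^+ (3 * n))^-1 (q ^+ 3) k
     * (qpoch x q k * qpoch (q / (q ^+ l * x)) q k
        / (qpoch q q k * qpoch (- (q / q ^+ l)) q k * qpoch q (q ^+ 2) k
           * qpoch (q ^+ (3 * n))^-1 q k))
     * q ^+ k.

Definition cubic_rhs q x l n : F :=
  \sum_(0 <= i < l.+1) expansion_coef q x l i *
    (qpoch (q * (q ^+ i * x)) (q ^+ 3) n * qpoch (q ^+ 2 / (q ^+ i * x)) (q ^+ 3) n
     / (qpoch q (q ^+ 3) n * qpoch (q ^+ 2) (q ^+ 3) n)).

(** Expanding and exchanging the sums leaves [cubic_sum] at q^i x. The last hypothesis allows x^2 =
    1 when l = 0, as the denominators of the identity do. *)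
Lemma cubic_identity_generic q x l n :
    q != 0 -> x != 0 -> (2 : F) != 0 -> (forall m, (0 < m)%N -> q ^+ m != 1) ->
    (forall i j, (0 < l)%N || (i != j) -> x ^+ 2 * q ^+ i != q ^+ j) ->
  cubic_lhs q x l n = cubic_rhs q x l n.
Proof.
move=> q0 x0 two0 q1 x2.
have qp1 j : 1 + q ^+ j.+1 != 0 by exact: add1_exprn_neq0.
have expand k : qpoch x q k * qpoch (q / (q ^+ l * x)) q k * qpoch (- q) q k
    / qpoch (- (q / q ^+ l)) q k = \sum_(0 <= i < l.+1) expansion_term q x l k i.
  case: l x2 => [|l] x2; last by apply: bracket_expansion => // i j; exact: x2.
  apply: bracket_expansion0 => //.
  by have := x2 0 1 isT; rewrite expr0 expr1 mulr1 subr_eq0 eq_sym.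
have pN k : qpoch (- q) q k != 0.
  by apply/prodf_neq0 => j _; rewrite mulNr opprK -exprS.
transitivity (\sum_(0 <= k < n.+1) \sum_(0 <= i < l.+1)
    expansion_coef q x l i * cubic_term q (q ^+ i * x) n k).
  apply: eq_bigr => k _.
  transitivity (qpoch (q ^+ (3 * n))^-1 (q ^+ 3) k
   / (qpoch q q k * qpoch (- q) q k * qpoch q (q ^+ 2) k
      * qpoch (q ^+ (3 * n))^-1 q k) * q ^+ k
   * (\sum_(0 <= i < l.+1) expansion_term q x l k i)).
    rewrite -expand; move: (pN k).
    move: (qpoch _ q k) (qpoch _ q k) (qpoch _ q k) (qpoch _ q k).
    move: (qpoch _ q k) (qpoch _ q k).
    move=> c1 c2 c3 c4 c5 c6 cN.
    (* Multiplies and divides by [qpoch (- q) q k], which is nonzero here. *)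
    by rewrite !invfM -[in LHS](mulfK cN c5); ring.
  rewrite mulr_sumr; apply: eq_bigr => i _.
  by rewrite /expansion_term /cubic_term; ring.
rewrite exchange_big; apply: eq_bigr => i _ /=.
by rewrite -mulr_sumr cubic_sum ?mulf_neq0 ?expf_neq0.
Qed.

End Identity.

(** * Evaluation of rational functions at a point *)

Local Notation tofrac := (@FracField.tofrac _).
Local Notation "x %:F" := (tofrac x).

Section Evaluation.
Variables (F : fieldType) (c : F).
Local Notation K := {fraction {poly F}}.

(** Says that f is regular at X = c with value v. A relation avoids both choosing a reduced fraction
    and giving a value at poles. *)
Definition evaluates (f : K) (v : F) : Prop :=
  exists N D : {poly F}, [/\ D.[c] != 0, f = N%:F / D%:F & v = N.[c] / D.[c]].

Lemma horner_neq0 (D : {poly F}) : D.[c] != 0 -> D%:F != 0.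
Proof. by apply: contra; rewrite tofrac_eq0 => /eqP ->; rewrite horner0. Qed.

(** Two representations of f agree after cross multiplication in F[X], and that polynomial identity
    can be evaluated at [c]. This brings an identity of F(X) back to F. *)
Lemma evaluates_inj f v w : evaluates f v -> evaluates f w -> v = w.
Proof.
move=> [N [D [D0 -> ->]]] [N' [D' [D'0 /eqP + ->]]].
rewrite eqr_div ?horner_neq0 // -!tofracM tofrac_eq => /eqP /(congr1 (horner^~ c)).
by rewrite !hornerM => h; apply/eqP; rewrite eqr_div // h.
Qed.

Lemma evaluatesC v : evaluates v%:P%:F v.
Proof. by exists v%:P, 1; rewrite tofrac1 hornerC hornerE oner_eq0 !divr1. Qed.

Lemma evaluatesX : evaluates 'X%:F c.
Proof. by exists 'X, 1; rewrite tofrac1 hornerX hornerE oner_eq0 !divr1. Qed.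

Lemma evaluates1 : evaluates 1 1.
Proof. by have := evaluatesC 1; rewrite polyC1 tofrac1. Qed.

Lemma evaluatesD f g v w :
  evaluates f v -> evaluates g w -> evaluates (f + g) (v + w).
Proof.
move=> [N [D [D0 -> ->]]] [N' [D' [D'0 -> ->]]].
exists (N * D' + N' * D), (D * D').
by rewrite !hornerE mulf_neq0 // !addf_div ?horner_neq0 // tofracD !tofracM.
Qed.

Lemma evaluatesM f g v w :
  evaluates f v -> evaluates g w -> evaluates (f * g) (v * w).
Proof.
move=> [N [D [D0 -> ->]]] [N' [D' [D'0 -> ->]]].
by exists (N * N'), (D * D'); split; rewrite ?hornerM ?mulf_neq0 ?tofracM ?mulf_div.
Qed.

Lemma evaluatesN f v : evaluates f v -> evaluates (- f) (- v).
Proof.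
by move=> [N [D [D0 -> ->]]]; exists (- N), D; rewrite !hornerE tofracN !mulNr.
Qed.

Lemma evaluatesV f v : v != 0 -> evaluates f v -> evaluates f^-1 v^-1.
Proof.
move=> v0 [N [D [D0 -> ev]]]; exists D, N; rewrite ev !invf_div; split => //.
by apply: contra v0; rewrite ev => /eqP ->; rewrite mul0r.
Qed.

Lemma evaluatesB f g v w :
  evaluates f v -> evaluates g w -> evaluates (f - g) (v - w).
Proof. by move=> ef eg; apply: evaluatesD => //; apply: evaluatesN. Qed.

Lemma evaluates_div f g v w :
  w != 0 -> evaluates f v -> evaluates g w -> evaluates (f / g) (v / w).
Proof. by move=> w0 ef eg; apply: evaluatesM => //; apply: evaluatesV. Qed.

Lemma evaluatesXn f v m : evaluates f v -> evaluates (f ^+ m) (v ^+ m).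
Proof.
move=> h; elim: m => [|m IHm]; rewrite ?expr0 ?exprS; first exact: evaluates1.
exact: evaluatesM.
Qed.

Lemma evaluates_sum m (f : nat -> K) (v : nat -> F) :
    (forall i, (i < m)%N -> evaluates (f i) (v i)) ->
  evaluates (\sum_(0 <= i < m) f i) (\sum_(0 <= i < m) v i).
Proof.
elim: m => [|m IHm] h.
  by rewrite !big_geq //; have := evaluatesC 0; rewrite polyC0 tofrac0.
by rewrite !big_nat_recr //=; apply: evaluatesD; [apply: IHm => i /ltnW|]; apply: h.
Qed.

Lemma evaluates_qpoch a p v w m :
  evaluates a v -> evaluates p w -> evaluates (qpoch a p m) (qpoch v w m).
Proof.
move=> ea ep; elim: m => [|m IHm]; first by rewrite !qpoch0; apply: evaluates1.
rewrite !qpochS; apply: evaluatesM => //; apply: evaluatesB; first exact: evaluates1.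
by apply: evaluatesM => //; apply: evaluatesXn.
Qed.

End Evaluation.

(** * Specialization of the generic identity at X = q *)

Section Specialization.
Variables (F : fieldType) (q x : F) (l n : nat).
Hypotheses (q0 : q != 0) (x0 : x != 0) (two0 : (2 : F) != 0).
Hypothesis lhs0 : forall k, (k <= n)%N ->
  qpoch q q k * qpoch (- (q / q ^+ l)) q k * qpoch q (q ^+ 2) k
  * qpoch (q ^+ (3 * n))^-1 q k != 0.
Hypothesis pre0 : qpoch (x ^+ 2) q l * qpoch (- 1) q l != 0.
Hypothesis vwp0 : 1 - x ^+ 2 / q != 0.
Hypothesis coef0 : forall i, (i <= l)%N ->
  qpoch q q i * qpoch (x ^+ 2 * q ^+ l) q i != 0.
Hypothesis rhs0 : qpoch q (q ^+ 3) n * qpoch (q ^+ 2) (q ^+ 3) n != 0.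

(** [Q] is the indeterminate, while [X] is the constant x viewed in F(X). *)
Let Q : {fraction {poly F}} := 'X%:F.
Let X : {fraction {poly F}} := x%:P%:F.

(** Descends through an expression; quotients are tried before products, of which they are a special
    case. The hypotheses above group the denominators as they occur, so that they close the side
    conditions. *)
Ltac evaluate := repeat first
  [ apply: evaluatesX | apply: evaluatesC | apply: evaluates1
  | apply: evaluates_div => // | apply: evaluatesV => // | apply: evaluatesB
  | apply: evaluatesD | apply: evaluatesN | apply: evaluatesM
  | apply: evaluates_qpoch | apply: evaluatesXn | by rewrite ?mulf_neq0 ?expf_neq0 ].

Lemma evaluates_lhs : evaluates q (cubic_lhs Q X l n) (cubic_lhs q x l n).
Proof.
apply: evaluates_sum => k; rewrite ltnS => kn; have := lhs0 kn => k0.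
by evaluate.
Qed.

Lemma evaluates_rhs : evaluates q (cubic_rhs Q X l n) (cubic_rhs q x l n).
Proof.
apply: evaluates_sum => i; rewrite ltnS => il; have := coef0 il => i0.
rewrite /expansion_coef.
by evaluate.
Qed.

Lemma cubic_identity : cubic_lhs q x l n = cubic_rhs q x l n.
Proof.
apply: (evaluates_inj evaluates_lhs).
rewrite cubic_identity_generic; first exact: evaluates_rhs.
- by rewrite tofrac_eq0 polyX_eq0.
- by rewrite tofrac_eq0 polyC_eq0.
- have -> : 2 = (2%:P : {poly F})%:F :> {fraction {poly F}}.
    by rewrite !rmorph_nat.
  by rewrite tofrac_eq0 polyC_eq0.
(* X is not a root of unity, by comparison of degrees. *)
- move=> m m0; rewrite -tofracXn -tofrac1 tofrac_eq.
  apply/negP => /eqP /(congr1 (fun p : {poly F} => size p)).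
  by rewrite size_polyXn size_poly1 => -[m1]; rewrite m1 in m0.
(* If x^2 X^i = X^j, degrees give i = j and leading coefficients give x^2 = 1. Then l > 0, and
   [pre0] fails through the first factor of [qpoch (x ^+ 2) q l]. *)
move=> i j h; rewrite -!tofracXn -tofracM tofrac_eq -polyC_exp mul_polyC.
apply/negP => /eqP e.
have x20 : x ^+ 2 != 0 by rewrite expf_neq0.
have eij : i = j.
  have := congr1 (fun p : {poly F} => size p) e.
  by rewrite size_scale // !size_polyXn => -[].
move: h e; rewrite eij eqxx orbF => l0 /(congr1 (coefp j)).
rewrite /= coefZ coefXn eqxx mulr1 => e.
move: pre0; rewrite -(prednK l0) qpochSl e subrr !mul0r eqxx //.
Qed.
End Specialization.

(** * Translation of the brackets and integer powers into the forms used above *)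

Theorem theorem1 (R : realType) (q s : R[i]) (hs : s ^+ 2 = q)
  (l n : nat) (x : R[i])
  (hq : q != 0) (hx : x != 0)
  (hL : forall k : nat, (k <= n)%N ->
     qbracket_defined
       [:: q; - q ^ (1 - l%:Z); s; - s; q ^ (- (3 * n)%:Z)] q k)
  (hP : qbracket_defined [:: x ^+ 2; -1] q l)
  (hV : 1 - x ^+ 2 * q ^ (-1) != 0)
  (hI : forall i : nat, (i <= l)%N ->
     qbracket_defined [:: q; x ^+ 2 * q ^+ l] q i)
  (hN : qbracket_defined [:: q; q ^+ 2] (q ^+ 3) n) :
  \sum_(0 <= k < n.+1)
     qpoch (q ^ (- (3 * n)%:Z)) (q ^+ 3) k
     * qbracket [:: x; q ^ (1 - l%:Z) / x]
                [:: q; - q ^ (1 - l%:Z); s; - s; q ^ (- (3 * n)%:Z)] q k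
     * q ^+ k
  = qbracket [:: x; - x] [:: x ^+ 2; -1] q l
    * \sum_(0 <= i < l.+1)
        (-1) ^+ i * q ^+ (l * i)
        * ((1 - x ^+ 2 * q ^ ((2 * i)%:Z - 1)) / (1 - x ^+ 2 * q ^ (-1)))
        * qbracket [:: q ^ (- l%:Z); x ^+ 2 * q ^ (-1)]
                   [:: q; x ^+ 2 * q ^+ l] q i
        * qbracket [:: q ^+ i.+1 * x; q ^ (2 - i%:Z) / x]
                   [:: q; q ^+ 2] (q ^+ 3) n.
Proof.
have zN m : q ^ (- m%:Z) = (q ^+ m)^-1 by rewrite -invr_expz.
have zB a b : q ^ (a%:Z - b%:Z) = q ^+ a / q ^+ b by rewrite expfzDr // zN.
have z1 : q ^ (-1) = q^-1 by rewrite (zN 1%N).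
have z1l m : q ^ (1 - m%:Z) = q / q ^+ m := zB 1%N m.
have z2 m : q ^ (2 - m%:Z) = q ^+ 2 / q ^+ m := zB 2%N m.
have z2i i : q ^ ((2 * i)%:Z - 1) = q ^+ i ^+ 2 / q.
  by rewrite (zB (2 * i)%N 1%N) mulnC exprM.
have big2 (a b p : R[i]) m :
    \prod_(c <- [:: a; b]) qpoch c p m = qpoch a p m * qpoch b p m.
  by rewrite !big_cons big_nil mulr1.
(* Here s disappears: the factorials at s and -s combine into one with parameter s^2 = q and base
   q^2. *)
have big5 (a b p : R[i]) m : \prod_(c <- [:: a; b; s; - s; p]) qpoch c q m
    = qpoch a q m * qpoch b q m * qpoch q (q ^+ 2) m * qpoch p q m.
  by rewrite !big_cons big_nil mulr1 -hs -(qpoch_mul_opp s) hs !mulrA.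
have def2 (a b p : R[i]) m :
    qbracket_defined [:: a; b] p m -> qpoch a p m * qpoch b p m != 0.
  by move=> h; rewrite mulf_neq0 // h // !inE eqxx ?orbT.
have two0 : (2 : R[i]) != 0 by rewrite Num.Theory.pnatr_eq0.
have lhs0 k : (k <= n)%N -> qpoch q q k * qpoch (- (q / q ^+ l)) q k
    * qpoch q (q ^+ 2) k * qpoch (q ^+ (3 * n))^-1 q k != 0.
  move=> kn; rewrite -big5 -z1l -zN prodf_seq_neq0.
  by apply/allP => b bin; apply: hL.
transitivity (cubic_lhs q x l n).
  apply: eq_bigr => k _; rewrite /qbracket big2 big5 zN z1l.
  by rewrite -(mulrA q) -invfM.
rewrite z1 in hV.
rewrite (cubic_identity hq hx two0 lhs0 (def2 _ _ _ _ hP) hV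
  (fun i il => def2 _ _ _ _ (hI i il)) (def2 _ _ _ _ hN)).
(* The prefactor goes inside the sum, since [expansion_coef] contains it. *)
rewrite /cubic_rhs mulr_sumr; apply: eq_bigr => i _.
rewrite /qbracket !big2 zN z2 z2i z1 /expansion_coef.
rewrite -[q ^+ 2 / _ / x]mulrA -invfM (exprS q i) -(mulrA q (q ^+ i) x).
by ring.
Qed.
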